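(* Let $L$ be a finite ranked lattice with rank function $\rho$ and Möbius function $\mu$, and let $(A_1,\dots,A_n)$ be an ordered partition of the atom set of $L$. Suppose that (1) for all $x\in L$ and all $\mathbf{t}\in\mathcal{T}_x^A$, $|\operatorname{supp}\mathbf{t}|=\rho(x)$; (2) for each $x\in L$ with $x\neq\hat{0}$ there is some $i$ with $|A_i\cap A_x|=1$. Then (a) for all $x\in L$, $\mu(x)=(-1)^{\rho(x)}|\mathcal{T}_x^A|$; and (b) $\chi(L,t)=t^{\rho(L)-n}\prod_{i=1}^n(t-|A_i|)$.
   Context: An atomic transversal is a tuple $\mathbf{t}=(t_1,\dots,t_n)$ with $t_i\in A_i\cup\{\hat{0}\}$ for each $i$. $\operatorname{supp}\mathbf{t}$ is the set of indices $i$ with $t_i\neq\hat{0}$ and $\bigvee\mathbf{t}=t_1\vee\cdots\vee t_n$ in $L$. For $x\in L$, $\mathcal{T}_x^A$ is the set of atomic transversals with $\bigvee\mathbf{t}=x$. $A_x$ denotes the set of atoms of $L$ below $x$. $\rho(L)$ is the maximum rank of an element of $L$, $\mu$ is defined by $\sum_{y\leq x}\mu(y)=\delta_{\hat{0},x}$, and $\chi(L,t)=\sum_{x\in L}\mu(x)t^{\rho(L)-\rho(x)}$. *)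

(* Defs.v *)
From HB Require Import structures.
From mathcomp Require Import all_boot all_order all_algebra.

Set Implicit Arguments.
Unset Strict Implicit.
Unset Printing Implicit Defensive.

Import Order.TTheory GRing.Theory Num.Theory.
Local Open Scope ring_scope.

Section Defs.
Variables (d : Order.disp_t) (L : finTBLatticeType d).
Implicit Types x y z : L.

Definition covers x y : bool :=
  (x < y)%O && [forall z, ~~ ((x < z)%O && (z < y)%O)].

(* A saturated \bot-x chain is \bot :: c with [path covers \bot c] and
   [last \bot c = x]; its length is [size c]. L is ranked when, for each x, all
   these chains have the same length, which is then the rank of x. *)
Definition is_rank_function (rho : L -> nat) : Prop :=
  forall x (c : seq L), path covers \bot%O c -> last \bot%O c = x ->
    size c = rho x.

Definition is_mobius (mu : L -> int) : Prop :=
  forall x, \sum_(y : L | (y <= x)%O) mu y = (x == \bot%O)%:R.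

Definition atoms : {set L} := [set a | covers \bot%O a].

Definition atoms_below x : {set L} := [set a in atoms | (a <= x)%O].

(* Blocks may be empty, as for partitions induced by a multichain. *)
Definition ordered_partition (n : nat) (A : 'I_n -> {set L}) (S : {set L}) :
    Prop :=
  \bigcup_(i < n) A i = S /\
  (forall i j : 'I_n, i != j -> [disjoint A i & A j]).

Definition supp (n : nat) (t : {ffun 'I_n -> L}) : {set 'I_n} :=
  [set i | t i != \bot%O].

Definition atomic_transversals (n : nat) (A : 'I_n -> {set L}) x :
    {set {ffun 'I_n -> L}} :=
  [set t : {ffun 'I_n -> L} |
    [forall i, t i \in A i :|: [set \bot%O]] &&
    ((\join_(i < n) t i)%O == x)].

Definition rank_of (rho : L -> nat) : nat := (\max_(x : L) rho x)%N.

Definition char_poly_of (rho : L -> nat) (mu : L -> int) : {poly int} :=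
  \sum_(x : L) mu x *: 'X^(rank_of rho - rho x).

End Defs.

Notation "p %:F" := (@FracField.tofrac _ p) : ring_scope.

(* Main.v *)
(** Let [f x] be the sum of [(-1) ^+ #|supp t|] over the atomic transversals [t]
    with join [x]. Summing [f] over [y <= x] yields a sum over the transversals
    with entries below [x], which factors as [\prod_i (1 - #|A_i :&: A_x|)]. For
    [x != 0] hypothesis (2) makes one factor vanish, so [f] satisfies the
    recurrence defining [mu]. The product formula for the characteristic
    polynomial is the same factorization with weights [t] on the bottom and
    [-1] on atoms. *)
Require Import Defs.
From mathcomp Require Import all_boot all_order all_algebra.

Set Implicit Arguments.
Unset Strict Implicit.
Unset Printing Implicit Defensive.

Import Order.TTheory GRing.Theory Num.Theory.
Local Open Scope ring_scope.

Section Mobius.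
Variables (d : Order.disp_t) (L : finTBLatticeType d).
Implicit Types (mu nu : L -> int).

(** The recurrence determines the value at [x] from the values strictly below [x], so induction on
    the number of elements strictly below [x] applies. *)
Lemma is_mobius_uniq mu nu : is_mobius mu -> is_mobius nu -> mu =1 nu.
Proof.
move=> Hmu Hnu x.
have [m] := ubnP #|[set y : L | (y < x)%O]|.
elim: m x => // m IH x /ltnSE le_m.
have := Hmu x; rewrite -(Hnu x) (bigD1 x) //= [in RHS](bigD1 x) //=.
rewrite (eq_bigr nu) => [/addIr //|y /andP[le_yx ne_yx]].
have lt_yx : (y < x)%O by rewrite lt_neqAle ne_yx.
apply: IH; apply: leq_trans le_m; apply: proper_card.
apply/properP; split; last by exists y; rewrite inE ?ltxx.
by apply/subsetP=> z; rewrite !inE => /lt_trans; apply.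
Qed.

End Mobius.

Section Transversals.
Variables (d : Order.disp_t) (L : finTBLatticeType d).
Variables (n : nat) (A : 'I_n -> {set L}).
Implicit Types (x : L) (t : {ffun 'I_n -> L}).

(** The blocks are a parameter so that both [A i] and the truncations [A i :&: atoms_below x] are
    covered. *)
Definition transversal_family (B : 'I_n -> {set L}) :=
  family (fun i => mem (B i :|: [set \bot%O])).

Lemma sum_transversals_join (V : nmodType) (P : pred L)
    (F : {ffun 'I_n -> L} -> V) :
  \sum_(x | P x) \sum_(t in atomic_transversals A x) F t =
  \sum_(t | (t \in transversal_family A) && P (\join_(i < n) t i)%O) F t.
Proof.
rewrite [RHS](partition_big (fun t => \join_(i < n) t i)%O P) /=; last first.
  by move=> t /andP[].
apply: eq_bigr => x Px; apply: eq_bigl => t; rewrite inE -andbA; congr andb.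
by case: eqP => [->|]; rewrite ?Px ?andbF.
Qed.

(** Expanding the product chooses in each factor either the bottom, with weight [a], or one of the
    elements of [B i], each with weight [b]. *)
Lemma sum_transversals_prod (R : comPzRingType) (B : 'I_n -> {set L}) (a b : R) :
    (forall i, \bot%O \notin B i) ->
  \sum_(t in transversal_family B)
     \prod_(i < n) (if t i == \bot%O then a else b) =
  \prod_(i < n) (a + b *+ #|B i|).
Proof.
move=> Bbot; rewrite -(bigA_distr_big_dep
  (fun i => [in B i :|: [set \bot%O]])
  (fun _ y => if y == \bot%O then a else b)) /=.
apply: eq_bigr => i _; rewrite setUC big_setU1 //= eqxx; congr (_ + _).
rewrite -sumr_const; apply: eq_bigr => y By.
by case: eqP By (Bbot i) => // -> ->.
Qed.

Lemma prod_weight_supp (R : comPzRingType) t (a b : R) :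
  \prod_(i < n) (if t i == \bot%O then a else b) =
  a ^+ (n - #|supp t|) * b ^+ #|supp t|.
Proof.
rewrite (bigID [in supp t]) /= mulrC; congr (_ * _).
  rewrite (eq_bigr (fun=> a)) => [|i]; last by rewrite inE negbK => ->.
  have -> : (n - #|supp t| = #|~: supp t|)%N.
    by rewrite [RHS]cardsCs setCK card_ord.
  by rewrite -prodr_const; apply: eq_bigl => i; rewrite !inE.
rewrite -prodr_const; apply: eq_bigr => i.
by rewrite inE => /negbTE->.
Qed.

Hypothesis HA : ordered_partition A (atoms L).

Lemma block_sub_atoms i : A i \subset atoms L.
Proof. by case: HA => <- _; apply: bigcup_sup. Qed.

Lemma bot_notin_block i : \bot%O \notin A i.
Proof.
by apply: contra (subsetP (block_sub_atoms i) _) _; rewrite inE /covers ltxx.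
Qed.

(** A join is below [x] exactly when every entry is, and the entries other than the bottom are
    atoms. *)
Lemma transversal_family_below x t :
  (t \in transversal_family A) && (\join_(i < n) t i <= x)%O =
  (t \in transversal_family (fun i => A i :&: atoms_below x)).
Proof.
apply/andP/familyP=> [[/familyP tA /joinsP tx] i|tB].
  have := tA i; rewrite !inE tx // => /orP[At|->]; last exact: orbT.
  by have := subsetP (block_sub_atoms i) _ At; rewrite At inE => ->.
split; [apply/familyP=> i | apply/joinsP=> i _]; have := tB i; rewrite !inE.
  by case/orP=> [/andP[->]|->] //; rewrite orbT.
by case/orP=> [/and3P[]|/eqP->].
Qed.

Definition signed_transversals x : int :=
  \sum_(t in atomic_transversals A x) (-1) ^+ #|supp t|.

Lemma signed_transversals_mobius :
    (forall x, x <> \bot%O -> exists i, #|A i :&: atoms_below x| = 1%N) ->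
  is_mobius signed_transversals.
Proof.
move=> H2 x; rewrite sum_transversals_join.
under eq_bigl do rewrite transversal_family_below.
have Bbot i : \bot%O \notin A i :&: atoms_below x.
  by rewrite inE (negbTE (bot_notin_block i)).
(* Weights [1] on the bottom and [-1] on atoms turn the product over entries into the sign. *)
transitivity (\prod_(i < n) (1 + -1 *+ #|A i :&: atoms_below x| : int)).
  rewrite -(sum_transversals_prod _ _ Bbot); apply: eq_bigr => t _.
  by rewrite prod_weight_supp expr1n mul1r.
(* For [x] nonzero a block with a single atom below [x] gives the factor [1 - 1]; below the bottom
   there are no atoms, so every factor is [1]. *)
have [->|/eqP /H2[i Ai1]] := eqVneq x \bot%O; last first.
  by rewrite (bigD1 i) //= Ai1 subrr mul0r.
rewrite big1 // => i _; suff -> : atoms_below \bot%O = set0 :> {set L}.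
  by rewrite setI0 cards0 addr0.
apply/setP=> a; rewrite !inE lex0 /covers.
by case: eqP => [->|]; rewrite ?ltxx ?andbF.
Qed.

End Transversals.

(* The product formula is stated in the field of fractions of Z[t], so that
   the exponent rho(L) - n is a genuine integer. *)
Theorem theorem4p2 (d : Order.disp_t) (L : finTBLatticeType d)
    (rho : L -> nat) (mu : L -> int) (n : nat) (A : 'I_n -> {set L})
    (Hrho : is_rank_function rho)
    (Hmu : is_mobius mu)
    (HA : ordered_partition A (atoms L))
    (H1 : forall (x : L) (t : {ffun 'I_n -> L}),
        t \in atomic_transversals A x -> #|supp t| = rho x)
    (H2 : forall x : L, x <> \bot%O ->
        exists i : 'I_n, #|A i :&: atoms_below x| = 1%N) :
  (forall x : L, mu x = (-1) ^+ rho x * (#|atomic_transversals A x|)%:R) /\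
  ((char_poly_of rho mu)%:F =
     ('X : {poly int})%:F ^ ((rank_of rho)%:Z - n%:Z) *
       \prod_(i < n) ('X - (#|A i|%:R)%:P)%:F :> {fraction {poly int}}).
Proof.
have muE := is_mobius_uniq Hmu (signed_transversals_mobius HA H2).
split=> [x|].
  rewrite muE mulr_natr -sumr_const; apply: eq_bigr => t /H1 -> //.
have X_neq0 : ('X : {poly int})%:F != 0 by rewrite tofrac_eq0 polyX_eq0.
rewrite /char_poly_of rmorph_sum /=.
(* Each factor takes the form [a + b *+ #|A i|] with [a] the indeterminate and [b = -1]. *)
under [X in _ * X]eq_bigr => i _ do
  rewrite rmorphB /= polyC_natr rmorph_nat -mulNrn.
rewrite -(sum_transversals_prod _ _ (bot_notin_block HA)).
(* A trivial condition on the join lets the transversals be grouped by their join [x], to match the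
   sum over [x] term by term. *)
under [X in _ * X]eq_bigl => t do rewrite -[_ \in _]andbT.
rewrite -(sum_transversals_join A predT) mulr_sumr; apply: eq_bigr => x _.
rewrite muE scaler_suml rmorph_sum mulr_sumr; apply: eq_bigr => t tx.
rewrite prod_weight_supp -(H1 x t tx) -mul_polyC rmorphM rmorphXn /=.
rewrite polyCN !rmorphXn rmorphN !rmorph1 mulrA mulrC /=; congr (_ * _).
(* Both natural subtractions in the exponents are truncated; these bounds make them agree with
   integer subtraction, where [n] cancels. *)
have le_n : (#|supp t| <= n)%N by have := max_card [in supp t]; rewrite card_ord.
have le_r : (#|supp t| <= rank_of rho)%N.
  by rewrite (H1 x t tx) /rank_of leq_bigmax.
rewrite !exprnP -expfzDr // -!subzn //; congr (_ ^ _).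
by rewrite addrA subrK.
Qed.
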